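(* Let $\mathcal{L}$ be a finite De Morgan lattice, let $G$ be a latticed Büchi game over $\mathcal{L}$, and let $l\in\mathcal{L}$. One can construct a Boolean generalized-Büchi game $G_l$ such that the $\vee$-player can achieve value greater than or equal to $l$ in $G$ using a single strategy if and only if the $\vee$-player wins in $G_l$. The size of $G_l$ is bounded by $|G|\cdot|\mathcal{L}|^2$ and $G_l$ has at most $|\mathcal{L}|$ acceptance sets.
   Context: A finite De Morgan lattice is a finite distributive lattice with a complement operation $\neg$ that is an involution satisfying De Morgan's laws and order-reversal. A latticed Büchi game $G$ consists of a finite set of vertices $V=V_\vee\cup V_\wedge$ (disjoint; $V_\vee$ owned by the $\vee$-player, $V_\wedge$ by the $\wedge$-player), an initial vertex $v_0$, an edge-valuation $E:V\times V\to\mathcal{L}$, and an $\mathcal{L}$-Büchi condition $F:V\to\mathcal{L}$; at each vertex its owner chooses the successor. For a play $p=u_0u_1\cdots$ define $r^\vee_0=\top$, $r^\wedge_0=\bot$, and for $i\ge0$: if $u_i\in V_\vee$ then $r^\vee_{i+1}=r^\vee_i\wedge(E(u_i,u_{i+1})\vee r^\wedge_i)$ and $r^\wedge_{i+1}=r^\wedge_i$; if $u_i\in V_\wedge$ then $r^\vee_{i+1}=r^\vee_i$ and $r^\wedge_{i+1}=r^\wedge_i\vee(E(u_i,u_{i+1})\wedge r^\vee_i)$. These sequences are monotone and stabilize to limits $r^\vee$, $r^\wedge$. The acceptance value $\mathit{acc}(p)$ is the join of $F(v)$ over vertices $v$ visited infinitely often, and the value of the play is $\mathit{val}(p)=r^\wedge\vee(r^\vee\wedge\mathit{acc}(p))$.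 The $\vee$-player achieves value at least $l$ using a single strategy if there is one $\vee$-player strategy $\pi$ such that every play from $v_0$ consistent with $\pi$ has value $\ge l$. A Boolean generalized-Büchi game is a two-player game on a graph whose winning condition for the $\vee$-player is a family of vertex sets each of which must be visited infinitely often. *)

(* Defs.v *)
From HB Require Import structures.
From mathcomp Require Import all_boot all_order.
From mathcomp Require Import boolp classical_sets.

Set Implicit Arguments.
Unset Strict Implicit.
Unset Printing Implicit Defensive.

Import Order.Theory.
Local Open Scope order_scope.

Definition de_morgan_compl d (L : tbDistrLatticeType d) (neg : L -> L) : Prop :=
  [/\ involutive neg,
      {morph neg : x y / x `&` y >-> x `|` y},
      {morph neg : x y / x `|` y >-> x `&` y} &
      {homo neg : x y /~ x <= y}].

Definition inf_often (T : Type) (p : nat -> T) (A : pred T) : Prop :=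
  forall n, exists2 m, (n <= m)%N & A (p m).

Definition eventually_eq (T : Type) (r : nat -> T) (x : T) : Prop :=
  exists n, forall m, (n <= m)%N -> r m = x.

(* The value at which [r] stabilizes. The default [\bot] is never used below:
   see [game_ror_stabilizes] and [game_rand_stabilizes]. *)
Definition stable_limit d (L : finTBDistrLatticeType d) (r : nat -> L) : L :=
  xget \bot [set x | eventually_eq r x].

Lemma homo_stabilizes d (L : finTBDistrLatticeType d) (r : nat -> L) :
  {homo r : m n / (m <= n)%N >-> m <= n} -> exists x, eventually_eq r x.
Proof.
move=> rle; pose f n := #|[pred x : L | r n <= x]|.
have [N /asboolP[n fn] Nmin] :=
  ex_minnP (ex_intro (fun k => `[< exists n, f n = k >]) (f 0)
             (asboolT (ex_intro _ 0 erefl))).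
exists (r n), n => m nm; apply/eqP; rewrite eq_sym; apply/eqP.
have sub : [pred x : L | r m <= x] \subset [pred x : L | r n <= x].
  by apply/fintype.subsetP => x; rewrite !inE; apply: le_trans; apply: rle.
have cardle : (f n <= f m)%N by rewrite fn Nmin //; apply/asboolP; exists m.
have /subset_cardP/(_ sub) eqmn : f m = f n.
  by apply/eqP; rewrite eqn_leq cardle subset_leq_card.
have := eqmn (r n); rewrite !inE lexx => rmn.
by apply/le_anti; rewrite rle.
Qed.

(* A strategy maps the history u_0 ... u_i, current vertex included, to the
   chosen successor u_{i+1}; [own] is the set of vertices of the player. *)
Definition strategy (V : Type) := seq V -> V.

Definition consistent (V : finType) (own : {set V}) (pi : strategy V)
    (p : nat -> V) : Prop :=
  forall i, p i \in own -> p i.+1 = pi (mkseq p i.+1).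

(* [lb_or] is V_\/ and its complement is V_/\ . Every vertex may be chosen as
   a successor of every vertex; [lb_edge] gives the value of the move. *)
Record latticed_buchi_game d (L : finTBDistrLatticeType d) := LatticedBuchiGame {
  lb_vertex :> finType;
  lb_or : {set lb_vertex};
  lb_init : lb_vertex;
  lb_edge : lb_vertex -> lb_vertex -> L;
  lb_acc : lb_vertex -> L
}.

Section LatticedGame.
Context {d : Order.disp_t} {L : finTBDistrLatticeType d}.
Variable G : latticed_buchi_game L.

(* One step of the pair (r^\/, r^/\) along the move from u to v. *)
Definition game_step (u v : G) (r : L * L) : L * L :=
  if u \in lb_or G then (r.1 `&` (lb_edge u v `|` r.2), r.2)
  else (r.1, r.2 `|` (lb_edge u v `&` r.1)).

Fixpoint game_r (p : nat -> G) (n : nat) : L * L :=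
  if n is i.+1 then game_step (p i) (p i.+1) (game_r p i) else (\top, \bot).

Definition game_ror (p : nat -> G) (n : nat) : L := (game_r p n).1.
Definition game_rand (p : nat -> G) (n : nat) : L := (game_r p n).2.

Definition acc_value (p : nat -> G) : L :=
  \join_(v : G | `[< inf_often p (pred1 v) >]) lb_acc v.

Definition play_value (p : nat -> G) : L :=
  stable_limit (game_rand p) `|` (stable_limit (game_ror p) `&` acc_value p).

Definition or_achieves (l : L) : Prop :=
  exists pi : strategy G, forall p : nat -> G,
    p 0 = lb_init G -> consistent (lb_or G) pi p -> l <= play_value p.

End LatticedGame.

Lemma game_rand_stabilizes d (L : finTBDistrLatticeType d)
    (G : latticed_buchi_game L) (p : nat -> G) :
  eventually_eq (game_rand p) (stable_limit (game_rand p)).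
Proof.
apply: (@xgetPex _ \bot [set x | eventually_eq (game_rand p) x]).
apply: homo_stabilizes; apply: homo_leq => [|y x z|i]; [exact: lexx| exact: le_trans |].
by rewrite /game_rand /= /game_step; case: ifP => //= _; rewrite leUl.
Qed.

Lemma game_ror_stabilizes d (L : finTBDistrLatticeType d)
    (G : latticed_buchi_game L) (p : nat -> G) :
  eventually_eq (game_ror p) (stable_limit (game_ror p)).
Proof.
apply: (@xgetPex _ \bot [set x | eventually_eq (game_ror p) x]).
apply: (@homo_stabilizes _ L^d) => m n mn; rewrite leEdual.
elim: n mn => [|n IHn]; first by rewrite leqn0 => /eqP->.
rewrite leq_eqVlt => /predU1P[->//|]; rewrite ltnS => /IHn; apply: le_trans.
by rewrite /game_ror /= /game_step; case: ifP => //= _; rewrite leIl.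
Qed.

(* [gb_or] is the set of vertices of the \/-player; there are no dead ends. *)
Record gen_buchi_game := GenBuchiGame {
  gb_vertex :> finType;
  gb_or : {set gb_vertex};
  gb_init : gb_vertex;
  gb_edge : rel gb_vertex;
  gb_total : forall x, exists y, gb_edge x y;
  gb_acc : seq {set gb_vertex}
}.

Definition gb_play (B : gen_buchi_game) (p : nat -> B) : Prop :=
  p 0 = gb_init B /\ forall i, gb_edge (p i) (p i.+1).

Definition gb_accepting (B : gen_buchi_game) (p : nat -> B) : Prop :=
  forall A, A \in gb_acc B -> inf_often p (mem A).

Definition gb_legal (B : gen_buchi_game) (pi : strategy B) : Prop :=
  forall h x, x \in gb_or B -> gb_edge x (pi (rcons h x)).

Definition or_wins (B : gen_buchi_game) : Prop :=
  exists2 pi : strategy B, gb_legal pi &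
    forall p : nat -> B,
      gb_play p -> consistent (gb_or B) pi p -> gb_accepting p.

Definition gb_edges (B : gen_buchi_game) : {set B * B} :=
  [set e | gb_edge e.1 e.2].

Definition join_irreducible d (L : finTBDistrLatticeType d) (j : L) : bool :=
  (j != \bot) &&
  [forall x : L, forall y : L, (j == x `|` y) ==> (j == x) || (j == y)].

(* [bool_game] is G_l: a vertex of G is paired with the current (r^\/, r^/\). Since l
   is the join of the join-irreducible j <= l, and such j are join-prime, a play
   has value >= l iff for each such j either r^/\ >= j in the limit, or
   r^\/ >= j in the limit and infinitely many visited v have F(v) >= j. *)
Section BooleanGame.
Context {d : Order.disp_t} {L : finTBDistrLatticeType d}.
Variables (G : latticed_buchi_game L) (l : L).

Definition bool_vertex : finType := (G * (L * L))%type.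

Definition bool_edge : rel bool_vertex :=
  fun x y => y.2 == game_step x.1 y.1 x.2.

Lemma bool_edge_total x : exists y, bool_edge x y.
Proof. by exists (x.1, game_step x.1 x.1 x.2); rewrite /bool_edge /=. Qed.

Definition bool_acc (j : L) : {set bool_vertex} :=
  [set x | (j <= x.2.2) || ((j <= x.2.1) && (j <= lb_acc x.1))].

Definition bool_game : gen_buchi_game :=
  @GenBuchiGame bool_vertex [set x | x.1 \in lb_or G]
    (lb_init G, (\top, \bot)) bool_edge bool_edge_total
    [seq bool_acc j | j <- enum L & join_irreducible j && (j <= l)].

End BooleanGame.

(* Main.v *)
(* Along a play of [G] the pair (r^\/, r^/\) is a function of the history, so
   plays and strategies of [G] correspond to plays and strategies of
   [bool_game G l]. An element of a finite distributive lattice lies above [l]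
   iff it lies above every join-irreducible j <= l, and each such j is
   join-prime, so j <= val(p) splits into the two disjuncts that define
   [bool_acc j]; the pigeonhole principle turns infinitely many visits to
   {v | j <= F(v)} into infinitely many visits to a single such v. *)
Require Import Defs.
From mathcomp Require Import all_boot all_order.
From mathcomp Require Import boolp.

Set Implicit Arguments.
Unset Strict Implicit.
Unset Printing Implicit Defensive.

Lemma eq_inf_often_from (T U : Type) (p : nat -> T) (A : pred T)
    (q : nat -> U) (B : pred U) (N : nat) :
    (forall n, N <= n -> A (p n) = B (q n)) ->
  inf_often p A <-> inf_often q B.
Proof.
move=> eqAB; split=> io n; have [m] := io (maxn N n);
  rewrite geq_max => /andP[le_Nm le_nm] Am; exists m => //.
  by rewrite -eqAB.
by rewrite eqAB.
Qed.

Lemma inf_often_pigeonhole (T : finType) (p : nat -> T) (A : pred T) :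
  inf_often p A -> exists2 v, A v & inf_often p (pred1 v).
Proof.
move=> io; apply: contrapT => none.
have bound v : exists n, A v -> forall m, n <= m -> p m != v.
  have [Av|nAv] := boolP (A v); last by exists 0.
  have : ~ inf_often p (pred1 v) by move=> iov; apply: none; exists v.
  move=> /existsNP[n late]; exists n => _ m le_nm; apply/negP => pm.
  by apply: late; exists m.
have [N NP] := choice bound.
(* Past the largest of the bounds [N v], no vertex satisfying [A] is visited. *)
have [m le_m Am] := io (\max_v N v).
have /negP[] // := NP (p m) Am m (leq_trans (leq_bigmax _) le_m).
Qed.

Section JoinIrreducible.
Import Order.Theory.
Local Open Scope order_scope.
Context {d : Order.disp_t} {L : finTBDistrLatticeType d}.
Implicit Types (j l x y : L).

Lemma join_irreducible_leU j x y :
  join_irreducible j -> (j <= x `|` y) = (j <= x) || (j <= y).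
Proof.
move=> /andP[_ /'forall_forallP ji].
apply/idP/orP => [le_j|[] le_j]; last 2 first.
- exact: le_trans le_j (leUl _ _).
- exact: le_trans le_j (leUr _ _).
(* By distributivity [j] is the join of these two meets, hence equal to one of them. *)
have /implyP := ji (j `&` x) (j `&` y).
rewrite -meetUr (meet_l le_j) eqxx => /(_ isT)/orP[]/eqP->; rewrite leIr; auto.
Qed.

Lemma join_irreducible_le_joins (I : finType) (P : pred I) (F : I -> L) j :
    join_irreducible j ->
  j <= \join_(i | P i) F i -> exists2 i, P i & j <= F i.
Proof.
move=> ji; elim/big_rec: _ => [|i x Pi IHx].
  by rewrite lex0; case/andP: ji => /negPf->.
by rewrite join_irreducible_leU // => /orP[|/IHx//]; exists i.
Qed.

(** Strong induction on the number of elements below [l]: if [l] is neither [\bot] nor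
    join-irreducible, it is the join of two elements strictly below it. *)
Lemma le_join_irreducible l x :
  (forall j, join_irreducible j -> j <= l -> j <= x) -> l <= x.
Proof.
have [n] := ubnP #|[pred y : L | y <= l]|.
elim: n l => // n IHn l lt_n below.
have [->|l0] := eqVneq l \bot; first exact: le0x.
have [ji|] := boolP (join_irreducible l); first exact: below.
rewrite /join_irreducible l0 /= negb_forall => /existsP[a].
rewrite negb_forall => /existsP[b]; rewrite negb_imply negb_or.
case/and3P => /eqP l_ab la lb.
have step c : c <= l -> l != c -> c <= x.
  move=> cl lc; apply: IHn => [|j ji jc]; last exact: below (le_trans jc cl).
  rewrite ltnS in lt_n; apply: leq_trans lt_n; apply: proper_card.
  apply/properP; split.
    by apply/subsetP => y; rewrite !inE => /le_trans->.
  by exists l; rewrite !inE ?lexx //; apply: contra lc => lc; rewrite eq_le lc.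
by rewrite l_ab leUx !step // l_ab ?leUl ?leUr // -l_ab.
Qed.

End JoinIrreducible.

Section Lifting.
Import Order.Theory.
Local Open Scope order_scope.
Context {d : Order.disp_t} {L : finTBDistrLatticeType d}.
Variable G : latticed_buchi_game L.
Implicit Types (p : nat -> G).

Lemma join_irreducible_le_acc_value p (j : L) :
    join_irreducible j ->
  j <= acc_value p <-> inf_often p (fun v => j <= lb_acc v).
Proof.
move=> ji; split=> [/(join_irreducible_le_joins ji)[v /asboolP io le_j] n|].
  by have [m le_nm /eqP pm] := io n; exists m; rewrite ?pm.
move=> /inf_often_pigeonhole[v le_j io].
by apply: le_trans le_j _; apply: joins_sup; apply/asboolP.
Qed.

Definition lift_play p (i : nat) : G * (L * L) := (p i, game_r p i).

(** This lets a strategy of [G], which sees only a finite history, recompute the pairs met so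
    far. *)
Lemma game_r_eq_upto p q n :
  (forall i, (i <= n)%N -> p i = q i) -> game_r p n = game_r q n.
Proof.
elim: n => //= n IHn eq_pq; rewrite !eq_pq // IHn // => i le_in.
by rewrite eq_pq // leqW.
Qed.

Lemma bool_acc_lift_play p (j : L) :
    join_irreducible j ->
  inf_often (lift_play p) (mem (bool_acc G j)) <-> j <= play_value p.
Proof.
move=> ji; rewrite /play_value join_irreducible_leU // lexI.
set ra := stable_limit (game_rand p); set ro := stable_limit (game_ror p).
have [[N1 stabA] [N2 stabO]] := (game_rand_stabilizes p, game_ror_stabilizes p).
pose A (v : G) := (j <= ra) || (j <= ro) && (j <= lb_acc v).
have io_A : inf_often (lift_play p) (mem (bool_acc G j)) <-> inf_often p A.
  (* From this index on both components equal their limits, so membership in [bool_acc G j] depends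
     on the current vertex only. *)
  apply: (@eq_inf_often_from _ _ _ _ _ _ (maxn N1 N2)) => n.
  rewrite geq_max => /andP[/stabA stabAn /stabO stabOn].
  by rewrite /= in_set /A /ra /ro -stabAn -stabOn.
apply: (iff_trans io_A); rewrite /A.
have [_|_] /= := boolP (j <= ra); first by split=> // _ n; exists n.
have [_|_] /= := boolP (j <= ro).
  by apply: iff_sym; apply: join_irreducible_le_acc_value.
by split=> // /(_ 0)[].
Qed.

Lemma gb_accepting_lift_play l p :
  @gb_accepting (bool_game G l) (lift_play p) <-> l <= play_value p.
Proof.
split=> [acc|le_l A /mapP[j]].
  apply: le_join_irreducible => j ji le_jl; apply/bool_acc_lift_play => //.
  by apply: acc; apply: map_f; rewrite mem_filter ji le_jl mem_enum.
rewrite mem_filter => /andP[/andP[ji le_jl] _] ->.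
by apply/bool_acc_lift_play => //; apply: le_trans le_l.
Qed.

(** An edge of [bool_game G l] determines the pair at its target from its source and the target's
    vertex of [G]. *)
Lemma gb_play_lift l (q : nat -> bool_game G l) :
  gb_play q -> q =1 lift_play (fun i => (q i).1).
Proof.
move=> [q0 edge]; elim=> [|i IHi]; first by rewrite /lift_play /= q0.
have /eqP qS := edge i; rewrite /lift_play /= [LHS]surjective_pairing qS.
by congr (_, game_step _ _ _); rewrite IHi.
Qed.

Lemma lift_play_gb_play l p :
  p 0 = lb_init G -> @gb_play (bool_game G l) (lift_play p).
Proof. by split=> [|i]; [rewrite /lift_play H | apply: eqxx]. Qed.

Lemma or_achieves_wins l : or_achieves G l -> or_wins (bool_game G l).
Proof.
case=> pi win.
(* The strategy [pi] is fed the projected history, and the pair forced by the edge relation is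
   attached to its choice. The default of [last] matters only for the empty history, which no play
   presents. *)
pose pi' (h : seq (bool_game G l)) : bool_game G l :=
  let x := last (gb_init (bool_game G l)) h in let v := pi (map fst h) in
  (v, game_step x.1 v x.2).
exists pi' => [h x _|q play_q cons_q].
  by rewrite /= /bool_edge /= last_rcons.
have q_lift := gb_play_lift play_q.
rewrite (funext q_lift); apply/gb_accepting_lift_play/win => [|i own_i].
  by case: play_q => ->.
by rewrite cons_q ?inE //= /mkseq -map_comp.
Qed.

Lemma or_wins_achieves l : or_wins (bool_game G l) -> or_achieves G l.
Proof.
case=> pi' legal win.
(* The default of [nth] only pads [h] to an infinite sequence: entries past the end of [h] do not
   influence the result. *)
pose lift_seq h := mkseq (lift_play (nth (lb_init G) h)) (size h).
have lift_mkseq p n : lift_seq (mkseq p n) = mkseq (lift_play p) n.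
  rewrite /lift_seq size_mkseq; apply: (@eq_from_nth _ (lift_play p 0)) => [|i].
    by rewrite !size_mkseq.
  rewrite size_mkseq => lt_in.
  rewrite !nth_mkseq // /lift_play nth_mkseq //; congr pair.
  apply: game_r_eq_upto => k le_ki.
  by rewrite nth_mkseq // (leq_ltn_trans le_ki).
exists (fun h => (pi' (lift_seq h)).1) => p p0 cons_p.
apply/gb_accepting_lift_play/win => [|i own_i]; first exact: lift_play_gb_play.
have own_pi : p i \in lb_or G by move: own_i; rewrite inE.
(* Consistency with the projected strategy controls only the vertex of [G]; legality of [pi'] forces
   the pair beside it. *)
have := legal (mkseq (lift_play p) i) _ own_i; rewrite -mkseqS => /eqP pi'2.
rewrite [RHS]surjective_pairing pi'2 /lift_play /= cons_p //.
by rewrite lift_mkseq.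
Qed.

End Lifting.

(** An edge is determined by its source and the [G]-component of its target. *)
Lemma card_bool_edges (d : Order.disp_t) (L : finTBDistrLatticeType d)
    (G : latticed_buchi_game L) (l : L) :
  #|gb_edges (bool_game G l)| <= #|bool_game G l| * #|G|.
Proof.
rewrite -card_prod -(@card_in_imset _ _ (fun e => (e.1, e.2.1))) ?max_card //.
move=> [x [v r]] [y [w s]]; rewrite !inE /= /bool_edge /= => /eqP-> /eqP->.
by case=> -> ->.
Qed.

Theorem theorem3 (d : Order.disp_t) (L : finTBDistrLatticeType d)
    (neg : L -> L) (negP : de_morgan_compl neg)
    (G : latticed_buchi_game L) (l : L) :
  [/\ or_achieves G l <-> or_wins (bool_game G l),
      #|bool_game G l| <= #|G| * #|L| ^ 2,
      #|gb_edges (bool_game G l)| <= #|G| ^ 2 * #|L| ^ 2 &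
      size (gb_acc (bool_game G l)) <= #|L|].
Proof.
have card_vertex : #|bool_game G l| = #|G| * #|L| ^ 2 by rewrite !card_prod.
split.
- by split; [apply: or_achieves_wins | apply: or_wins_achieves].
- by rewrite card_vertex.
- by rewrite (leq_trans (card_bool_edges _ _)) // card_vertex mulnAC.
- by rewrite size_map size_filter (leq_trans (count_size _ _)) // -cardE.
Qed.
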